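(* Let $B$ be a basis, $E_B=A_B^{-1}D_B\in\mathbb{R}^{m\times m}$, and let $\alpha\in\mathbb{R}^{m\times 1}$, $\beta\in\mathbb{R}^{1\times m}$ be such that $$F=\begin{pmatrix}E_B & \alpha\\ \beta & 0\end{pmatrix}$$ is diagonalizable, with eigendecomposition $F=Q\Sigma Q^{-1}$ ($Q$ invertible, $\Sigma$ diagonal, both $(m+1)\times(m+1)$). Let $R(\lambda)=I_{m+1}+\lambda\Sigma$ and let $u,v$ be column vectors of size $m+1$ such that $$uv^T = Q^{-1}\begin{pmatrix}\alpha\beta & 0\\ 0 & 0\end{pmatrix}Q.$$ Then, for every $\lambda$ such that $I_m+\lambda E_B$ and $R(\lambda)$ are invertible, $$x_B(\lambda)=\begin{pmatrix}I_m & 0\end{pmatrix}Q\left(R^{-1}(\lambda)-\frac{\lambda^2R^{-1}(\lambda)uv^TR^{-1}(\lambda)}{1+\lambda^2v^TR^{-1}(\lambda)u}\right)Q^{-1}\begin{pmatrix}I_m\\ 0\end{pmatrix}x_B(0).$$ Moreover, for such a given $\lambda$, $x_B(\lambda)$ and $o_B(\lambda)$ can be computed in $\mathcal{O}(m^2)$ once the decomposition is computed (that is, after a preprocessing that does not depend on $\lambda$).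
   Context: Let $A, D \in \mathbb{R}^{m\times n}$, $b\in\mathbb{R}^m$, $c\in\mathbb{R}^n$, and for $\lambda\in\mathbb{R}$ let $\mathcal{P}(\lambda)$ be the linear program $\min\{c^T x : Ax+\lambda Dx=b,\ x\ge 0\}$. A basis $B$ is a choice of $m$ column indices such that $A_B$ is invertible; $M_B$ denotes the submatrix of a matrix $M$ (or subvector of a vector) formed by the columns (entries) indexed by $B$. Whenever $A_B+\lambda D_B$ is invertible (equivalently $I_m+\lambda E_B$ is invertible), $x_B(\lambda) = (A_B+\lambda D_B)^{-1}b$ and $o_B(\lambda) = c_B^T x_B(\lambda)$; in particular $x_B(0)=A_B^{-1}b$. Eigendecompositions are over $\mathbb{C}$; $v^T$ is the plain (non-conjugate) transpose; $I_k$ is the $k\times k$ identity. Complexity is the number of arithmetic operations over $\mathbb{C}$ (unit cost); $Q,\Sigma,Q^{-1},u,v,x_B(0)$ and any other quantity not depending on $\lambda$ may be computed once in the preprocessing, whose cost is not counted in the per-$\lambda$ cost. *)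

(* Defs.v *)
From HB Require Import structures.
From mathcomp Require Import all_boot all_order all_algebra.
From mathcomp Require Import reals complex.

Set Implicit Arguments.
Unset Strict Implicit.
Unset Printing Implicit Defensive.

Import Order.TTheory GRing.Theory Num.Theory.
Local Open Scope ring_scope.

(* A basis is given as an enumeration B of its m column indices; the columns
   of M indexed by B are [colsub B M], the corresponding entries of a column
   vector c are [rowsub B c].  Invertibility of A_B forces B to be injective. *)
Definition is_basis (R : realType) (m n : nat) (A : 'M[R]_(m, n))
    (B : 'I_m -> 'I_n) : bool :=
  colsub B A \in unitmx.

Definition EB (R : realType) (m n : nat) (A D : 'M[R]_(m, n))
    (B : 'I_m -> 'I_n) : 'M[R]_m :=
  invmx (colsub B A) *m colsub B D.

(* [invmx] is total: xB and oB are only meaningful when A_B + lambda D_B is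
   invertible. *)
Definition xB (R : realType) (m n : nat) (A D : 'M[R]_(m, n)) (b : 'cV[R]_m)
    (B : 'I_m -> 'I_n) (lambda : R) : 'cV[R]_m :=
  invmx (colsub B A + lambda *: colsub B D) *m b.

Definition oB (R : realType) (m n : nat) (A D : 'M[R]_(m, n)) (b : 'cV[R]_m)
    (c : 'cV[R]_n) (B : 'I_m -> 'I_n) (lambda : R) : R :=
  ((rowsub B c)^T *m xB A D b B lambda) 0 0.

Definition cmx (R : realType) (p q : nat) (M : 'M[R]_(p, q)) : 'M[R[i]]_(p, q) :=
  map_mx (real_complex R) M.

Definition Rmx (R : realType) (k : nat) (Sigma : 'M[R[i]]_k) (lambda : R) :
    'M[R[i]]_k :=
  1%:M + real_complex R lambda *: Sigma.

(* v^T R(lambda)^-1 u, a 1 x 1 matrix read as a scalar. *)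
Definition vRu (R : realType) (k : nat) (Sigma : 'M[R[i]]_k)
    (u v : 'cV[R[i]]_k) (lambda : R) : R[i] :=
  (v^T *m invmx (Rmx Sigma lambda) *m u) 0 0.

(* Unit-cost arithmetic model: straight-line programs acting on a growing list
   of field elements.  Every instruction appends one value to the store; its
   operands are positions in the store.  Reading a missing position or dividing
   by zero makes the execution fail. *)
Variant instr : Type :=
  | Const of int
  | Add of nat & nat
  | Sub of nat & nat
  | Mul of nat & nat
  | Div of nat & nat.

Definition eval_instr (F : fieldType) (st : seq F) (i : instr) : option F :=
  let arg2 (op : F -> F -> option F) j k :=
    if (onth st j, onth st k) is (Some x, Some y) then op x y else None in
  match i with
  | Const z => Some z%:~R
  | Add j k => arg2 (fun x y => Some (x + y)) j k
  | Sub j k => arg2 (fun x y => Some (x - y)) j k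
  | Mul j k => arg2 (fun x y => Some (x * y)) j k
  | Div j k => arg2 (fun x y => if y == 0 then None else Some (x / y)) j k
  end.

Fixpoint exec (F : fieldType) (code : seq instr) (st : seq F) : option (seq F) :=
  if code is i :: code' then
    if eval_instr st i is Some x then exec code' (rcons st x) else None
  else Some st.

(* [preproc] is run once on the data and never sees the parameter; [online] is
   run for each value of the parameter, on the store left by [preproc] with
   that value added in front; [outs] lists the positions of the results. *)
Record algorithm : Type := Algorithm {
  preproc : seq instr;
  online : seq instr;
  outs : seq nat
}.

Definition online_cost (a : algorithm) : nat := size (online a).

Definition run (F : fieldType) (a : algorithm) (data : seq F) (lambda : F) :
    option (seq F) :=
  if exec (preproc a) data is Some st then
    if exec (online a) (lambda :: st) is Some st' then
      if all (fun k => (k < size st')%N) (outs a)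
      then Some [seq nth 0 st' k | k <- outs a] else None
    else None
  else None.

Definition entries (T : Type) (p q : nat) (M : 'M[T]_(p, q)) : seq T :=
  [seq M i j | i <- enum 'I_p, j <- enum 'I_q].

(* All real data are embedded in R[i]; the number of entries depends
   on m only. *)
Definition offline_data (R : realType) (m n : nat) (A D : 'M[R]_(m, n))
    (b : 'cV[R]_m) (c : 'cV[R]_n) (B : 'I_m -> 'I_n)
    (alpha : 'cV[R]_m) (beta : 'rV[R]_m)
    (Q Sigma : 'M[R[i]]_(m + 1)) (u v : 'cV[R[i]]_(m + 1)) : seq R[i] :=
  entries (cmx (colsub B A)) ++ entries (cmx (colsub B D)) ++
  entries (cmx b) ++ entries (cmx (rowsub B c)) ++
  entries (cmx alpha) ++ entries (cmx beta) ++
  entries Q ++ entries Sigma ++ entries (invmx Q) ++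
  entries u ++ entries v ++ entries (cmx (xB A D b B 0)).

(* Main.v *)
Require Import Defs.
From HB Require Import structures.
From mathcomp Require Import all_boot all_order all_algebra.
From mathcomp Require Import reals complex zify.

Set Implicit Arguments.
Unset Strict Implicit.
Unset Printing Implicit Defensive.

Import Order.TTheory GRing.Theory Num.Theory.
Local Open Scope ring_scope.

(** Bordering E with alpha and beta makes (I + l E)^-1 accessible from the
    eigendecomposition of F = (E alpha; beta 0), even when E itself is not
    diagonalizable.  The Schur complement of the corner 1 in I + l F is
    I + l E - l^2 alpha beta; adding l^2 (alpha beta 0; 0 0), a matrix of rank
    at most one, turns this Schur complement into I + l E.  So the upper left
    block of the inverse of the corrected matrix P is (I + l E)^-1
    ([bordered_unitmx_invmx]).  In the eigenbasis, P is the diagonal matrix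
    R(l) = I + l Sigma plus the rank-one term l^2 u v^T.  It is invertible
    because I + l E is, and the Sherman-Morrison formula ([sherman_morrison])
    gives both its inverse and the fact that the denominator does not vanish.
    Together these are [bordered_update]; applied to
    A_B + l D_B = A_B (I + l E_B) they give the formula for x_B(l).

    For the complexity, the formula is evaluated from right to left, so that
    only vectors occur.  R(l) is diagonal, hence R(l)^-1 costs one division
    per coordinate; the rank-one term costs two inner products; the
    multiplications by Q^-1 and Q are the only quadratic steps.  For
    m > 0 everything is done in the part of the algorithm that runs once per
    parameter, directly on the data, in 4 m^2 + 18 m + 20 instructions, which
    is at most 42 m^2.

    Straight-line programs refer to values by absolute positions, which is
    unwieldy for composition.  They are therefore produced by builders, which
    take the current store size, return code and the positions of its results,
    and compose by [bind].  The predicate [costs] counts the instructions, and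
    [yields] is a Hoare triple about execution; since stores only grow, a known
    position stays valid in every later store ([onth_extend]). *)

(** * Inverting a bordered matrix after a rank-one correction *)

Section LinearAlgebra.
Variable F : fieldType.

(** The denominator cannot vanish: if v^T N^-1 u = -1, then N^-1 u lies in the
    kernel of N + u v^T, so N^-1 u = 0 and v^T N^-1 u = 0, a contradiction. *)
Lemma sherman_morrison (k : nat) (N : 'M[F]_k) (u v : 'cV[F]_k) :
    N \in unitmx -> N + u *m v^T \in unitmx ->
  let s := (v^T *m invmx N *m u) 0 0 in
  1 + s != 0 /\
  invmx (N + u *m v^T) =
    invmx N - (1 + s)^-1 *: (invmx N *m (u *m v^T) *m invmx N).
Proof.
move=> Nu NUu s.
have vNu : v^T *m invmx N *m u = s%:M by rewrite [LHS]mx11_scalar.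
have s1 : 1 + s != 0.
  apply/eqP=> s1; have: (N + u *m v^T) *m (invmx N *m u) = 0.
    rewrite mulmxDl mulKVmx // -mulmxA (mulmxA v^T) vNu mul_mx_scalar.
    by rewrite -[X in X + _]scale1r -scalerDl s1 scale0r.
  move=> /(congr1 (mulmx (invmx (N + u *m v^T)))).
  rewrite mulKmx // mulmx0 => Nu0.
  have s0 : s = 0 by rewrite /s -mulmxA Nu0 mulmx0 mxE.
  by move: s1; rewrite s0 addr0 => /eqP; rewrite oner_eq0.
split=> //; apply: (can_inj (mulKmx NUu)); rewrite mulmxV //.
(* Z^2 = s Z, so (1 + Z) (1 - Z / (1 + s)) = 1. *)
set Z := u *m v^T *m invmx N.
have NUZ : (N + u *m v^T) *m invmx N = 1%:M + Z by rewrite mulmxDl mulmxV.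
have ZZ : Z *m Z = s *: Z.
  rewrite /Z !mulmxA -(mulmxA u v^T) -(mulmxA u _ u) vNu mul_mx_scalar.
  by rewrite -!scalemxAl mulmxA.
rewrite mulmxBr -scalemxAr NUZ.
rewrite -[X in _ - _ *: (_ *m X)]mulmxA -/Z [X in _ - _ *: X]mulmxA NUZ.
by rewrite mulmxDl mul1mx ZZ -{2}[Z]scale1r -scalerDl scalerA mulVf // scale1r addrK.
Qed.

(** M is the Schur complement of the corner 1 of P. *)
Lemma bordered_unitmx_invmx (m : nat) (M : 'M[F]_m) (a : 'cV[F]_m)
    (b : 'rV[F]_m) (P := block_mx (M + a *m b) a b 1%:M) :
  M \in unitmx ->
  P \in unitmx /\ row_mx 1%:M 0 *m invmx P *m col_mx 1%:M 0 = invmx M.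
Proof.
move=> Mu.
have Pu : P \in unitmx.
  (* Clearing the upper right block leaves M and 1 on the diagonal. *)
  have -> : P = block_mx 1%:M a 0 1%:M *m block_mx M 0 b 1%:M.
    by rewrite mulmx_block !mul1mx !mul0mx mulmx1 !add0r.
  by rewrite unitmx_mul !unitmxE det_ublock det_lblock !det1 !mulr1 unitr1 -unitmxE.
split=> //.
(* The right factor is the first block column of the inverse of P. *)
have -> : col_mx 1%:M 0 = P *m col_mx (invmx M) (- (b *m invmx M)) :> 'M_(m + 1, m).
  rewrite mul_block_col mul1mx subrr mulmxN mulmxDl mulmxV // -mulmxA.
  by rewrite addrK.
by rewrite -mulmxA mulKmx // mul_row_col mul1mx mul0mx addr0.
Qed.

Lemma diag_mx_unit_entry (k : nat) (N : 'M[F]_k) (i : 'I_k) :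
  is_diag_mx N -> N \in unitmx -> N i i != 0.
Proof.
move=> Nd Nu; apply: contraTneq Nu => Ni0.
case/diag_mxP: Nd => d dN.
rewrite dN unitmxE det_diag unitfE; apply/negPn/prodf_eq0; exists i => //.
by move: Ni0; rewrite dN mxE eqxx mulr1n => ->.
Qed.

Lemma invmx_diag_mul (k : nat) (N : 'M[F]_k) (x : 'cV[F]_k) :
    is_diag_mx N -> N \in unitmx ->
  invmx N *m x = \col_i (x i 0 / N i i).
Proof.
move=> Nd Nu; apply: (can_inj (mulKmx Nu)); rewrite mulKVmx //.
apply/colP=> i; have Ni := diag_mx_unit_entry i Nd Nu.
rewrite mxE (bigD1 i) //= mxE mulrC divfK // big1 ?addr0 // => j ji.
by rewrite (is_diag_mxP Nd) ?mul0r // eq_sym.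
Qed.

End LinearAlgebra.

Section UpdatedSolution.
Variables (F : fieldType) (m : nat) (Q W Sigma : 'M[F]_(m + 1)).
Variables (u v : 'cV[F]_(m + 1)) (x0 : 'cV[F]_m) (l : F).
Let Rinv := invmx (1%:M + l *: Sigma).

Definition update_denom : F := 1 + l ^+ 2 * (v^T *m Rinv *m u) 0 0.

(** The matrix W stands for the inverse of Q: straight-line programs read it
    from their input instead of inverting Q. *)
Definition updated_solution : 'cV[F]_m :=
  row_mx 1%:M 0 *m Q *m
  (Rinv - update_denom^-1 *: (l ^+ 2 *: (Rinv *m (u *m v^T) *m Rinv))) *m
  W *m col_mx 1%:M 0 *m x0.

End UpdatedSolution.

(** The corrected bordered matrix P of [bordered_unitmx_invmx], with borders
    l a and l b, is similar through Q to 1 + l Sigma + l^2 u v^T. *)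
Lemma bordered_update (F : fieldType) (m : nat) (E : 'M[F]_m) (a : 'cV[F]_m)
    (b : 'rV[F]_m) (Q Sigma : 'M[F]_(m + 1)) (u v : 'cV[F]_(m + 1))
    (x0 : 'cV[F]_m) (l : F) :
    Q \in unitmx -> block_mx E a b 0 = Q *m Sigma *m invmx Q ->
    u *m v^T = invmx Q *m block_mx (a *m b) 0 0 0 *m Q ->
    1%:M + l *: E \in unitmx -> 1%:M + l *: Sigma \in unitmx ->
  update_denom Sigma u v l != 0 /\
  invmx (1%:M + l *: E) *m x0 = updated_solution Q (invmx Q) Sigma u v x0 l.
Proof.
move=> Qu FE uvE Mu Ru; set R := 1%:M + l *: Sigma.
have [] := bordered_unitmx_invmx (l *: a) (l *: b) Mu; set P := block_mx _ _ _ _.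
have PE : P = Q *m (R + (l ^+ 2 *: u) *m v^T) *m invmx Q.
  rewrite -scalemxAl uvE mulmxDr mulmxDl -scalemxAr -scalemxAl.
  rewrite !mulmxA mulmxV // mul1mx mulmxK // mulmxDr mulmx1 mulmxDl mulmxV //.
  rewrite -scalemxAr -scalemxAl -FE scalar_mx_block.
  rewrite !scale_block_mx !add_block_mx /P -scalemxAl -scalemxAr scalerA.
  by rewrite !scaler0 !addr0 !add0r expr2.
rewrite PE => Pu <-.
have Nu : R + (l ^+ 2 *: u) *m v^T \in unitmx.
  by move: Pu; rewrite !unitmx_mul Qu unitmx_inv Qu andbT.
have [] := sherman_morrison Ru Nu; rewrite -scalemxAr mxE => den0 NE.
split=> //.
have -> : invmx (Q *m (R + (l ^+ 2 *: u) *m v^T) *m invmx Q) =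
          Q *m invmx (R + (l ^+ 2 *: u) *m v^T) *m invmx Q.
  apply: (can_inj (mulKmx Pu)); rewrite mulmxV // !mulmxA mulmxKV //.
  by rewrite mulmxK // mulmxV.
by rewrite NE -scalemxAl -scalemxAr -scalemxAl /updated_solution !mulmxA.
Qed.

(** * Composable straight-line programs *)

(** The argument is the size of the store at which the code will start; the
    second component holds the positions of the results. *)
Definition builder (A : Type) : Type := nat -> seq instr * A.

Definition emit (i : instr) : builder nat := fun k => ([:: i], k).

Definition ret (A : Type) (a : A) : builder A := fun=> ([::], a).

Definition bind (A A' : Type) (g : builder A) (h : A -> builder A') :
    builder A' :=
  fun k => let: (code, a) := g k in
           let: (code', a') := h a (k + size code)%N in
           (code ++ code', a').

Notation "x <~ g ; h" := (bind g (fun x => h))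
  (at level 85, g at level 84, right associativity).

Section Combinators.
Variable I : eqType.

Fixpoint vector (s : seq I) (g : I -> builder nat) : builder (I -> nat) :=
  if s is i :: s' then
    p <~ g i; ps <~ vector s' g; ret (fun j => if j == i then p else ps j)
  (* Position 0 is a dummy for indices that do not occur in s. *)
  else ret (fun=> 0).

Fixpoint dot (s : seq I) (p q : I -> nat) : builder nat :=
  if s is i :: s' then
    a <~ dot s' p q; t <~ emit (Mul (p i) (q i)); emit (Add t a)
  else emit (Const 0).

End Combinators.

Definition tabulate (I : finType) (g : I -> builder nat) := vector (enum I) g.

Definition inner (I : finType) (p q : I -> nat) := dot (enum I) p q.

(** An exact count, uniform in the starting store size, so that costs add up
    along [bind]. *)
Definition costs (A : Type) (g : builder A) (c : nat) : Prop :=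
  forall k, size (g k).1 = c.

Lemma costs_emit i : costs (emit i) 1. Proof. by []. Qed.

Lemma costs_ret (A : Type) (a : A) : costs (ret a) 0. Proof. by []. Qed.

Lemma costs_bind (A A' : Type) (g : builder A) (h : A -> builder A') c c' :
  costs g c -> (forall a, costs (h a) c') -> costs (bind g h) (c + c').
Proof.
move=> gc hc k; rewrite /bind; have := gc k; case: (g k) => code a /= codec.
have := hc a (k + size code)%N; case: (h a _) => code' a' /= code'c.
by rewrite size_cat codec code'c.
Qed.

Lemma costs_vector (I : eqType) (s : seq I) g c :
  (forall i, costs (g i) c) -> costs (vector s g) (size s * c).
Proof.
move=> gc; elim: s => [|i s IHs] //=.
apply: costs_bind => // p; rewrite -[X in costs _ X]addn0.
by apply: costs_bind => // ps; apply: costs_ret.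
Qed.

Lemma costs_dot (I : eqType) (s : seq I) p q : costs (dot s p q) (size s).*2.+1.
Proof.
elim: s => [|i s IHs] //=; rewrite doubleS -[X in costs _ X]addn2.
by apply: costs_bind => // a; apply: (@costs_bind _ _ _ _ 1 1).
Qed.

Lemma costs_tabulate (I : finType) (g : I -> builder nat) c :
  (forall i, costs (g i) c) -> costs (tabulate g) (#|I| * c).
Proof. by rewrite cardE; apply: costs_vector. Qed.

Lemma costs_inner (I : finType) (p q : I -> nat) : costs (inner p q) #|I|.*2.+1.
Proof. by rewrite cardE; apply: costs_dot. Qed.

Section Correctness.
Variable F : fieldType.
Implicit Types (st : seq F) (x y : F).

(** Code only appends to the store, so the final store is st ++ st'; the
    postcondition sees this store and the positions returned. *)
Definition yields (A : Type) st (g : builder A) (post : seq F -> A -> Prop) :=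
  exists2 st', exec (g (size st)).1 st = Some (st ++ st') &
               post (st ++ st') (g (size st)).2.

Lemma exec_cat code code' st :
  exec (code ++ code') st = obind (exec code') (exec code st).
Proof. by elim: code st => //= i code IHc st; case: eval_instr. Qed.

Lemma size_exec code st st' :
  exec code st = Some st' -> size st' = (size st + size code)%N.
Proof.
elim: code st => [|i code IHc] st /=; first by move=> [<-]; rewrite addn0.
by case: eval_instr => // x /IHc->; rewrite size_rcons addnS.
Qed.

Lemma onth_extend st st' p x : onth st p = Some x -> onth (st ++ st') p = Some x.
Proof.
by move=> px; rewrite onth_cat -onthTE px.
Qed.

Lemma yields_ret (A : Type) st (a : A) (post : seq F -> A -> Prop) :
  post st a -> yields st (ret a) post.
Proof. by move=> sta; exists [::]; rewrite cats0. Qed.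

(** The code of h runs on a store that extends st, so facts about st carry over
    through [onth_extend] and need not be repeated in P. *)
Lemma yields_bind (A A' : Type) st (g : builder A) (h : A -> builder A') P Q :
    yields st g P ->
    (forall st' a, P (st ++ st') a -> yields (st ++ st') (h a) Q) ->
  yields st (bind g h) Q.
Proof.
rewrite /yields /bind => -[st1]; case: (g (size st)) => code a /= runc Pa hP.
have [st2] := hP st1 a Pa; rewrite (size_exec runc).
case: (h a _) => code' a' /= runc' Qa'.
exists (st1 ++ st2); last by rewrite catA.
by rewrite exec_cat runc /= runc' catA.
Qed.

Lemma yields_emit st i x :
  eval_instr st i = Some x -> yields st (emit i) (fun st' p => onth st' p = Some x).
Proof.
move=> ix; exists [:: x]; first by rewrite /= ix cats1.
by rewrite onth_cat ltnn subnn.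
Qed.

Lemma yields_const st z :
  yields st (emit (Const z)) (fun st' p => onth st' p = Some z%:~R).
Proof. exact: yields_emit. Qed.

Lemma yields_add st p q x y : onth st p = Some x -> onth st q = Some y ->
  yields st (emit (Add p q)) (fun st' r => onth st' r = Some (x + y)).
Proof. by move=> px qy; apply: yields_emit; rewrite /= px qy. Qed.

Lemma yields_sub st p q x y : onth st p = Some x -> onth st q = Some y ->
  yields st (emit (Defs.Sub p q)) (fun st' r => onth st' r = Some (x - y)).
Proof. by move=> px qy; apply: yields_emit; rewrite /= px qy. Qed.

Lemma yields_mul st p q x y : onth st p = Some x -> onth st q = Some y ->
  yields st (emit (Mul p q)) (fun st' r => onth st' r = Some (x * y)).
Proof. by move=> px qy; apply: yields_emit; rewrite /= px qy. Qed.

Lemma yields_div st p q x y : y != 0 -> onth st p = Some x -> onth st q = Some y ->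
  yields st (emit (Div p q)) (fun st' r => onth st' r = Some (x / y)).
Proof.
by move=> y0 px qy; apply: yields_emit; rewrite /= px qy (negPf y0).
Qed.

Lemma yields_vector (I : eqType) (s : seq I) st (g : I -> builder nat) (x : I -> F) :
    (forall st' i,
      yields (st ++ st') (g i) (fun st'' p => onth st'' p = Some (x i))) ->
  yields st (vector s g)
    (fun st' ps => forall i, i \in s -> onth st' (ps i) = Some (x i)).
Proof.
elim: s st => [|i s IHs] st gx /=; first exact: yields_ret.
apply: yields_bind => [|st1 p px].
  by have := gx [::] i; rewrite cats0; apply.
apply: yields_bind => [|st2 ps psx].
  by apply: IHs => st2 j; rewrite -catA; apply: gx.
apply: yields_ret => j; rewrite inE; case: eqP => [-> _|_] /=; last exact: psx.
exact: onth_extend.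
Qed.

Lemma yields_dot (I : eqType) (s : seq I) st (p q : I -> nat) (x y : I -> F) :
    (forall i, onth st (p i) = Some (x i)) ->
    (forall i, onth st (q i) = Some (y i)) ->
  yields st (dot s p q)
    (fun st' r => onth st' r = Some (\sum_(i <- s) x i * y i)).
Proof.
move=> px qy; elim: s => [|i s IHs] /=.
  by rewrite big_nil; apply: yields_const.
rewrite big_cons; apply: yields_bind IHs _ => st1 a ax.
apply: yields_bind => [|st2 t tx].
  by apply: yields_mul; apply: onth_extend.
by apply: yields_add => //; apply: onth_extend.
Qed.

Lemma yields_tabulate (I : finType) st (g : I -> builder nat) (x : I -> F) :
    (forall st' i,
      yields (st ++ st') (g i) (fun st'' p => onth st'' p = Some (x i))) ->
  yields st (tabulate g) (fun st' ps => forall i, onth st' (ps i) = Some (x i)).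
Proof.
move=> /(yields_vector (enum I))[st' runc psx].
by exists st' => // i; apply: psx; rewrite mem_enum.
Qed.

Lemma yields_inner (I : finType) st (p q : I -> nat) (x y : I -> F) a :
    (forall i, onth st (p i) = Some (x i)) ->
    (forall i, onth st (q i) = Some (y i)) ->
    a = \sum_i x i * y i ->
  yields st (inner p q) (fun st' r => onth st' r = Some a).
Proof. by move=> px qy ->; rewrite -big_enum; apply: yields_dot. Qed.

End Correctness.

(** * Evaluating the updated solution with quadratically many operations *)

Section Solver.
Variables (m : nat) (l : nat) (Qp Wp : 'I_(m + 1) -> 'I_(m + 1) -> nat).
Variables (sp up vp : 'I_(m + 1) -> nat) (cp xp : 'I_m -> nat).

(** The update formula evaluated from right to left, without ever forming a
    product of two matrices: with z = R^-1 y and w = R^-1 u, the rank-one term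
    subtracts the multiple g w from z, where g = l^2 v^T z / (1 + l^2 v^T w).
    The identity blocks of the formula select the first m columns of W and the
    first m rows of Q, hence [lshift]. *)
Definition solver : builder (('I_m -> nat) * nat) :=
  one <~ emit (Const 1);
  y <~ tabulate (fun k => inner (fun j => Wp k (lshift 1 j)) xp);
  r <~ tabulate (fun k => t <~ emit (Mul l (sp k)); emit (Add one t));
  z <~ tabulate (fun k => emit (Div (y k) (r k)));
  w <~ tabulate (fun k => emit (Div (up k) (r k)));
  vz <~ inner vp z;
  vw <~ inner vp w;
  l2 <~ emit (Mul l l);
  num <~ emit (Mul l2 vz);
  t <~ emit (Mul l2 vw);
  den <~ emit (Add one t);
  g <~ emit (Div num den);
  q <~ tabulate (fun k => t <~ emit (Mul g (w k)); emit (Defs.Sub (z k) t));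
  x <~ tabulate (fun i => inner (Qp (lshift 1 i)) q);
  o <~ inner cp x;
  ret (x, o).

Lemma costs_solver : costs solver (4 * m ^ 2 + 18 * m + 20).
Proof.
set N := #|'I_(m + 1)|; set M := #|'I_m|.
(* One summand for each line of [solver]. *)
have -> : (4 * m ^ 2 + 18 * m + 20 =
  1 + (N * M.*2.+1 + (N * (1 + 1) + (N * 1 + (N * 1 + (N.*2.+1 + (N.*2.+1 +
  (1 + (1 + (1 + (1 + (1 + (N * (1 + 1) + (M * N.*2.+1 + (M.*2.+1 + 0)
  ))))))))))))))%N.
  by rewrite /N /M !card_ord; lia.
have emit2 (h : nat -> instr) i : costs (t <~ emit i; emit (h t)) (1 + 1).
  by apply: costs_bind => // ?; apply: costs_emit.
do 15 (apply: costs_bind => [|?];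
  first by (exact: costs_emit || exact: costs_inner ||
            apply: costs_tabulate => ?;
              (exact: costs_inner || exact: costs_emit || exact: emit2))).
exact: costs_ret.
Qed.

Variables (F : fieldType) (st : seq F) (lam : F).
Variables (Q W Sigma : 'M[F]_(m + 1)) (u v : 'cV[F]_(m + 1)) (c x0 : 'cV[F]_m).
Let R := 1%:M + lam *: Sigma.
Let X := updated_solution Q W Sigma u v x0 lam.

(** The diagonal entries of R are nonzero because R is invertible, and the last
    division is by [update_denom]; so no division fails. *)
Lemma yields_solver :
    onth st l = Some lam ->
    (forall i j, onth st (Qp i j) = Some (Q i j)) ->
    (forall i j, onth st (Wp i j) = Some (W i j)) ->
    (forall i, onth st (sp i) = Some (Sigma i i)) ->
    (forall i, onth st (up i) = Some (u i 0)) ->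
    (forall i, onth st (vp i) = Some (v i 0)) ->
    (forall i, onth st (cp i) = Some (c i 0)) ->
    (forall i, onth st (xp i) = Some (x0 i 0)) ->
    is_diag_mx Sigma -> R \in unitmx -> update_denom Sigma u v lam != 0 ->
  yields st solver (fun st' xo =>
    (forall i, onth st' (xo.1 i) = Some (X i 0)) /\
    onth st' xo.2 = Some ((c^T *m X) 0 0)).
Proof.
move=> lE QE WE sE uE vE cE xE Sd Ru den0.
pose t := (v^T *m invmx R *m u) 0 0.
have Rd : is_diag_mx R.
  apply/is_diag_mxP=> i j ij; rewrite !mxE (is_diag_mxP Sd) //.
  by rewrite -val_eqE (negPf ij) mulr0 addr0.
have RE i : R i i = 1 + lam * Sigma i i by rewrite !mxE eqxx.
have R0 i : R i i != 0 by apply: diag_mx_unit_entry.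
pose y := W *m col_mx 1%:M 0 *m x0; pose z := invmx R *m y.
pose w := invmx R *m u; pose s := (v^T *m z) 0 0.
pose g := lam ^+ 2 * s / update_denom Sigma u v lam.
pose q : 'cV_(m + 1) := z - g *: w.
have XE : X = row_mx 1%:M 0 *m Q *m q.
  rewrite /X /updated_solution -!(mulmxA (_ *m Q)); congr (_ *m _).
  rewrite -(mulmxA _ W) -(mulmxA _ (W *m _)) -/y mulmxBl /q /z; congr (_ - _).
  rewrite scalerA -scalemxAl -!mulmxA -/z [v^T *m z]mx11_scalar -/s.
  by rewrite mul_mx_scalar -scalemxAr scalerA -/w -mulrA mulrC.
have yE k : y k 0 = \sum_j W k (lshift 1 j) * x0 j 0.
  rewrite /y -mulmxA mul_col_mx mul1mx mul0mx mxE big_split_ord /=.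
  rewrite [X in _ + X]big1 ?addr0.
    by apply: eq_bigr => j _; rewrite col_mxEu.
  by move=> j _; rewrite col_mxEd mxE mulr0.
have zE k : z k 0 = y k 0 / R k k by rewrite /z invmx_diag_mul // mxE.
have wE k : w k 0 = u k 0 / R k k by rewrite /w invmx_diag_mul // mxE.
have tE : t = \sum_k v k 0 * w k 0.
  by rewrite /t -mulmxA mxE; apply: eq_bigr => k _; rewrite mxE.
have sE' : s = \sum_k v k 0 * z k 0.
  by rewrite /s mxE; apply: eq_bigr => k _; rewrite mxE.
have qE k : q k 0 = z k 0 - g * w k 0 by rewrite !mxE.
have XiE i : X i 0 = \sum_k Q (lshift 1 i) k * q k 0.
  rewrite XE -mulmxA -[Q in LHS]vsubmxK mul_col_mx mul_row_col mul1mx mul0mx addr0.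
  by rewrite mxE; apply: eq_bigr => k _; rewrite mxE.
have oE : (c^T *m X) 0 0 = \sum_i c i 0 * X i 0.
  by rewrite mxE; apply: eq_bigr => k _; rewrite mxE.
(* With this in the context, eauto finds known positions in extended stores. *)
have persist := @onth_extend F.
apply: (yields_bind (yields_const _ _)) => st1 one /= oneE.
apply: yields_bind.
  apply: (yields_tabulate (x := fun k => y k 0)) => st2 k.
  by apply: yields_inner (yE k) => j; eauto 20.
move=> st2 yp /= ypE; apply: yields_bind.
  apply: (yields_tabulate (x := fun k => R k k)) => st3 k; rewrite RE.
  apply: yields_bind => [|st4 a /= aE]; first by apply: yields_mul; eauto 20.
  by apply: yields_add; eauto 20.
move=> st3 rp /= rpE; apply: yields_bind.
  apply: (yields_tabulate (x := fun k => z k 0)) => st4 k; rewrite zE.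
  by apply: (yields_div (R0 k)); eauto 20.
move=> st4 zp /= zpE; apply: yields_bind.
  apply: (yields_tabulate (x := fun k => w k 0)) => st5 k; rewrite wE.
  by apply: (yields_div (R0 k)); eauto 20.
move=> st5 wp /= wpE; apply: yields_bind.
  by apply: yields_inner sE' => k; eauto 20.
move=> st6 vz /= vzE; apply: yields_bind.
  by apply: yields_inner tE => k; eauto 20.
move=> st7 vw /= vwE; apply: yields_bind; first by apply: yields_mul; eauto 20.
rewrite -expr2 => st8 l2 /= l2E; apply: yields_bind.
  by apply: yields_mul; eauto 20.
move=> st9 num /= numE; apply: yields_bind; first by apply: yields_mul; eauto 20.
move=> st10 a /= aE; apply: yields_bind; first by apply: yields_add; eauto 20.
move=> st11 den /= denE; apply: yields_bind.
  by apply: (yields_div den0); eauto 20.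
rewrite -/g => st12 gp /= gpE; apply: yields_bind.
  apply: (yields_tabulate (x := fun k => q k 0)) => st13 k; rewrite qE.
  apply: yields_bind => [|st14 b /= bE]; first by apply: yields_mul; eauto 20.
  by apply: yields_sub; eauto 20.
move=> st13 qp /= qpE; apply: yields_bind.
  apply: (yields_tabulate (x := fun i => X i 0)) => st14 i.
  by apply: yields_inner (XiE i) => k; eauto 20.
move=> st14 Xp /= XpE; apply: yields_bind.
  by apply: yields_inner oE => i; eauto 20.
by move=> st15 op /= opE; apply: yields_ret; split=> //=; eauto 20.
Qed.

End Solver.

(** * The algorithm on the flattened data *)

Lemma size_entries (T : Type) p q (M : 'M[T]_(p, q)) : size (entries M) = (p * q)%N.
Proof. by rewrite size_allpairs !size_enum_ord. Qed.

Lemma onth_allpairs (S T U : Type) (f : S -> T -> U) (s : seq S) (t : seq T)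
    x y i j :
  onth s i = Some x -> onth t j = Some y ->
  onth [seq f x y | x <- s, y <- t] (i * size t + j) = Some (f x y).
Proof.
move=> + jy; have jt : (j < size t)%N by rewrite -onthTE jy.
elim: s i => [|x' s IHs] [|i] //= ix; rewrite onth_cat size_map.
  by case: ix => ->; rewrite mul0n jt onth_map jy.
by rewrite mulSn -addnA ltnNge leq_addr /= addKn; apply: IHs.
Qed.

Lemma onth_all_nth (T : Type) (x0 : T) s ks ys :
    [seq onth s k | k <- ks] = [seq Some y | y <- ys] ->
  all (fun k => k < size s)%N ks /\ [seq nth x0 s k | k <- ks] = ys.
Proof.
elim: ks ys => [|k ks IHks] [|y ys] //= [ky /IHks[-> ->]].
by rewrite -onthTE -odflt_onth ky.
Qed.

Lemma onth_enum_ord n (i : 'I_n) : onth (enum 'I_n) i = Some i.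
Proof.
by rewrite onthE (nth_map i) ?size_enum_ord // nth_ord_enum.
Qed.

Lemma onth_entries (T : Type) p q (M : 'M[T]_(p, q)) (i : 'I_p) (j : 'I_q) :
  onth (entries M) (i * q + j) = Some (M i j).
Proof.
have := onth_allpairs (fun i j => M i j) (onth_enum_ord i) (onth_enum_ord j).
by rewrite size_enum_ord.
Qed.

Lemma onth_flatten (T : Type) (ss : seq (seq T)) sh r k x :
    sh = shape ss -> onth (nth [::] ss r) k = Some x ->
  onth (flatten ss) (flatten_index sh r k) = Some x.
Proof.
move=> ->; rewrite /flatten_index; elim: ss r => [|s ss IHss] [|r] //= rk.
  by rewrite onth_cat -onthTE rk.
by rewrite -addnA onth_cat ltnNge leq_addr /= addKn; apply: IHss.
Qed.

(** The block sizes of [offline_data].  They depend on m alone, so that the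
    program can be written before any data is known. *)
Definition data_shape (m : nat) : seq nat :=
  let N := (m + 1)%N in
  [:: m * m; m * m; m * 1; m * 1; m * 1; 1 * m;
      N * N; N * N; N * N; N * 1; N * 1; m * 1]%N.

(** Position of the entry (i, j) of the r-th matrix, which has q columns.  The
    shift by one makes room for the parameter at position 0. *)
Definition entry_pos (m r q i j : nat) : nat :=
  (flatten_index (data_shape m) r (i * q + j)).+1.

(** The block numbers stand for Q (6), Sigma (7), Q^-1 (8), u (9), v (10),
    c_B (3) and x_B(0) (11). *)
Definition online_solver (m : nat) : builder (('I_m -> nat) * nat) :=
  let N := (m + 1)%N in
  solver 0 (fun i j => entry_pos m 6 N i j) (fun i j => entry_pos m 8 N i j)
    (fun i => entry_pos m 7 N i i) (fun i => entry_pos m 9 1 i 0)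
    (fun i => entry_pos m 10 1 i 0) (fun i => entry_pos m 3 1 i 0)
    (fun i => entry_pos m 11 1 i 0).

(** When m = 0, a bound proportional to m^2 leaves no instruction per
    parameter, while the objective value 0 is still to be returned; it is
    created once, right after the data. *)
Definition lp_algorithm (m : nat) : algorithm :=
  let size_data := sumn (data_shape m) in
  if m == 0 then Algorithm [:: Const 0] [::] [:: size_data.+1] else
  let: (code, (x, o)) := online_solver m size_data.+1 in
  Algorithm [::] code (rcons [seq x i | i <- enum 'I_m] o).

Lemma online_cost_lp_algorithm m : (online_cost (lp_algorithm m) <= 42 * m ^ 2)%N.
Proof.
rewrite /online_cost /lp_algorithm; case: eqVneq => // m_neq0.
have : costs (online_solver m) (4 * m ^ 2 + 18 * m + 20) by apply: costs_solver.
move=> /(_ (sumn (data_shape m)).+1).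
(* 42 = 4 + 18 + 20, and m <= m^2, 1 <= m^2. *)
by case: (online_solver _ _) => code [x o] /= ->; nia.
Qed.

Section Data.
Variables (R : realType) (m n : nat) (A D : 'M[R]_(m, n)) (b : 'cV[R]_m).
Variables (c : 'cV[R]_n) (B : 'I_m -> 'I_n) (alpha : 'cV[R]_m) (beta : 'rV[R]_m).
Variables (Q Sigma : 'M[R[i]]_(m + 1)) (u v : 'cV[R[i]]_(m + 1)).

Let data := offline_data A D b c B alpha beta Q Sigma u v.

Let blocks : seq (seq R[i]) :=
  [:: entries (cmx (colsub B A)); entries (cmx (colsub B D)); entries (cmx b);
      entries (cmx (rowsub B c)); entries (cmx alpha); entries (cmx beta);
      entries Q; entries Sigma; entries (invmx Q); entries u; entries v;
      entries (cmx (xB A D b B 0))].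

Let shape_blocks : data_shape m = shape blocks.
Proof. by rewrite /= !size_entries. Qed.

Let flatten_blocks : data = flatten blocks.
Proof. by rewrite /= cats0. Qed.

Lemma size_offline_data : size data = sumn (data_shape m).
Proof. by rewrite shape_blocks -size_flatten flatten_blocks. Qed.

Lemma onth_entry_pos l r p q (M : 'M_(p, q)) (i : 'I_p) (j : 'I_q) :
    nth [::] blocks r = entries M ->
  onth (l :: data) (entry_pos m r q i j) = Some (M i j).
Proof.
move=> rM; rewrite /= flatten_blocks; apply: onth_flatten shape_blocks _.
by rewrite rM onth_entries.
Qed.

Lemma run_lp_algorithm (l : R[i])
    (x := updated_solution Q (invmx Q) Sigma u v (cmx (xB A D b B 0)) l) :
    is_diag_mx Sigma -> 1%:M + l *: Sigma \in unitmx ->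
    update_denom Sigma u v l != 0 ->
  run (lp_algorithm m) data l =
    Some (entries x ++ [:: ((cmx (rowsub B c))^T *m x) 0 0]).
Proof.
move=> Sd Ru den0.
have : yields (l :: data) (online_solver m) (fun st xo =>
    (forall i, onth st (xo.1 i) = Some (x i 0)) /\
    onth st xo.2 = Some (((cmx (rowsub B c))^T *m x) 0 0)).
  apply: yields_solver => // [i j|i j|i|i|i|i|i].
  - exact: (@onth_entry_pos l 6).
  - exact: (@onth_entry_pos l 8).
  - exact: (@onth_entry_pos l 7).
  - exact: (@onth_entry_pos l 9 _ _ u i 0).
  - exact: (@onth_entry_pos l 10 _ _ v i 0).
  - exact: (@onth_entry_pos l 3 _ _ (cmx (rowsub B c)) i 0).
  - exact: (@onth_entry_pos l 11 _ _ (cmx (xB A D b B 0)) i 0).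
have entries_x : entries x = [seq x i 0 | i <- enum 'I_m].
  rewrite /entries enum_ordSl; case: (enum 'I_0) (size_enum_ord 0) => //= _.
  by elim: (enum _) => //= i s ->.
rewrite entries_x /lp_algorithm /run; case: eqVneq => [m0 _ | _].
  have noI (i : 'I_m) : False by have := leq_trans (ltn_ord i) (eq_leq m0).
  have -> : enum 'I_m = [::] by apply: size0nil; rewrite size_enum_ord m0.
  rewrite mxE big1 => [|i]; last by case: (noI i).
  rewrite /= size_rcons size_offline_data ltnS leqnn /=.
  by rewrite nth_rcons size_offline_data ltnn eqxx.
case=> st; rewrite [size _]/= size_offline_data.
case: (online_solver _ _) => code [xp o] /= -> [xpE oE].
have outsE :
    [seq onth (l :: data ++ st) k | k <- rcons [seq xp i | i <- enum 'I_m] o] =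
    [seq Some y | y <- rcons [seq x i 0 | i <- enum 'I_m]
                             (((cmx (rowsub B c))^T *m x) 0 0)].
  by rewrite !map_rcons oE -!map_comp; congr rcons; apply: eq_map => i; apply: xpE.
by have [-> ->] := onth_all_nth 0 outsE; rewrite cats1.
Qed.

End Data.

Theorem theorem5 (R : realType) :
  exists (K : nat) (alg : nat -> algorithm),
    (forall m : nat, (online_cost (alg m) <= K * m ^ 2)%N) /\
    forall (m n : nat) (A D : 'M[R]_(m, n)) (b : 'cV[R]_m) (c : 'cV[R]_n)
      (B : 'I_m -> 'I_n),
      is_basis A B ->
    forall (alpha : 'cV[R]_m) (beta : 'rV[R]_m) (Q Sigma : 'M[R[i]]_(m + 1)),
      Q \in unitmx ->
      is_diag_mx Sigma ->
      cmx (block_mx (EB A D B) alpha beta 0) = Q *m Sigma *m invmx Q ->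
    forall u v : 'cV[R[i]]_(m + 1),
      u *m v^T =
        invmx Q *m cmx (block_mx (alpha *m beta) 0 0 (0 : 'M[R]_1)) *m Q ->
    forall lambda : R,
      1%:M + lambda *: EB A D B \in unitmx ->
      Rmx Sigma lambda \in unitmx ->
      let l := real_complex R lambda in
      let Rinv := invmx (Rmx Sigma lambda) in
      [/\ 1 + l ^+ 2 * vRu Sigma u v lambda != 0,
          cmx (xB A D b B lambda) =
            row_mx 1%:M 0 *m Q *m
            (Rinv - (1 + l ^+ 2 * vRu Sigma u v lambda)^-1 *:
                      (l ^+ 2 *: (Rinv *m (u *m v^T) *m Rinv))) *m
            invmx Q *m col_mx 1%:M 0 *m cmx (xB A D b B 0)
        & run (alg m) (offline_data A D b c B alpha beta Q Sigma u v) l =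
            Some (entries (cmx (xB A D b B lambda)) ++
                  [:: real_complex R (oB A D b c B lambda)])].
Proof.
exists 42, lp_algorithm; split=> [m|]; first exact: online_cost_lp_algorithm.
move=> m n A D b c B basisB alpha beta Q Sigma Qu Sd FE u v uvE lambda Mu Ru l Rinv.
have xBE : xB A D b B lambda =
    invmx (1%:M + lambda *: EB A D B) *m xB A D b B 0.
  have ADE : colsub B A + lambda *: colsub B D =
      colsub B A *m (1%:M + lambda *: EB A D B).
    by rewrite mulmxDr mulmx1 -scalemxAr /EB mulKVmx.
  have ADu : colsub B A + lambda *: colsub B D \in unitmx.
    by rewrite ADE unitmx_mul Mu andbT.
  apply: (can_inj (mulKmx ADu)).
  by rewrite /xB mulKVmx // ADE scale0r addr0 -mulmxA mulKVmx // mulKVmx.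
have cMu : 1%:M + l *: cmx (EB A D B) = cmx (1%:M + lambda *: EB A D B).
  by rewrite /cmx map_mxD map_mxZ map_mx1.
have [] := @bordered_update _ _ (cmx (EB A D B)) (cmx alpha) (cmx beta) Q Sigma u v
  (cmx (xB A D b B 0)) l Qu.
- by rewrite -FE /cmx map_block_mx map_mx0.
- by rewrite uvE /cmx map_block_mx !map_mx0 map_mxM.
- by rewrite cMu /cmx map_unitmx.
- by [].
rewrite cMu /cmx -map_invmx -map_mxM -xBE -/(cmx _) => den0 xE.
split=> //; rewrite run_lp_algorithm // -xE; congr (Some (_ ++ [:: _])).
by rewrite /oB !mxE rmorph_sum; apply: eq_bigr => i _; rewrite !mxE rmorphM.
Qed.
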